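(* For every real $\varepsilon$ with $0<\varepsilon\le 1$ and every integer $n\ge 2$, $$\lim_{H\to\infty}\frac{D_{n,\varepsilon}(H)}{2H^{1-\varepsilon}(2H)^n}=1,$$ where, for a positive integer $H$, $D_{n,\varepsilon}(H)$ denotes the number of dominant polynomials $f(X)=a_0X^n+a_1X^{n-1}+\cdots+a_n\in\mathbb{Z}[X]$ with $0<|a_0|\le H^{1-\varepsilon}$ and $|a_i|\le H$ for $i=1,\ldots,n$.
   Context: A polynomial $f\in\mathbb{C}[X]$ of degree $n\ge 2$ with roots $\alpha_1,\ldots,\alpha_n\in\mathbb{C}$ (listed with multiplicity) is called dominant if there is an index $i$ such that $|\alpha_i|>|\alpha_j|$ for all $j\ne i$; equivalently, $f$ has a simple root whose modulus is strictly greater than the moduli of all its remaining roots. $H$ runs through positive integers. *)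

(* Defs.v *)
From mathcomp Require Import all_boot all_order all_algebra.
From mathcomp Require Import finmap complex zify.
From mathcomp Require Import all_classical all_reals all_analysis.

Set Implicit Arguments.
Unset Strict Implicit.
Unset Printing Implicit Defensive.

Import Order.TTheory GRing.Theory Num.Theory.
Import numFieldNormedType.Exports.

Local Open Scope classical_set_scope.
Local Open Scope ring_scope.
Local Open Scope complex_scope.

(* Used with C := R[i]. The norm takes values in C; on moduli, the partial order
   of C restricts to the usual order of the nonnegative reals. *)
Definition dominant (C : numClosedFieldType) (f : {poly C}) : Prop :=
  exists (n : nat) (alpha : 'I_n -> C),
    [/\ (2 <= n)%N,
        size f = n.+1,
        f = lead_coef f *: \prod_(i < n) ('X - (alpha i)%:P) &
        exists i : 'I_n, forall j : 'I_n, j != i -> `|alpha j| < `|alpha i|].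

(* The coefficient a_i of a_0 X^n + ... + a_n is f`_(n - i). *)
Definition dominant_box (R : realType) (n : nat) (eps : R) (H : nat) :
    set {poly int} :=
  [set f : {poly int} |
    [/\ (size f <= n.+1)%N,
        0 < `|f`_n|,
        (`|f`_n|)%:~R <= H%:R `^ (1 - eps),
        forall i : nat, (1 <= i <= n)%N -> `|f`_(n - i)| <= H%:Z &
        @dominant R[i] (map_poly intr f)]].

Lemma finite_dominant_box (R : realType) (n : nat) (eps : R) (H : nat) :
  finite_set (dominant_box n eps H).
Proof.
pose B := (Num.truncn (H%:R `^ (1 - eps)) + H)%N.
pose g (a : {ffun 'I_n.+1 -> 'I_(B.*2).+1}) : {poly int} :=
  \poly_(i < n.+1) ((a (inord i) : nat)%:Z - B%:Z).
apply: (@sub_finite_set _ _ (g @` setT)); last first.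
  by apply: finite_image; exact: finite_finset.
move=> f [sf _ fn fi _].
have hB k : (k <= n)%N -> (absz (f`_k)%R <= B)%N.
  move=> kn; rewrite /B; have [->|kn'] := eqVneq k n.
    apply: leq_trans (leq_addr _ _).
    by rewrite truncn_ge_nat ?powR_ge0.
  apply: leq_trans (leq_addl _ _).
  have nk : (0 < n - k <= n)%N by lia.
  by have := fi _ nk; rewrite subKn// -lez_nat abszE.
exists [ffun i : 'I_n.+1 => inord (absz (f`_i + B%:Z)%R)] => //.
apply/polyP => k; rewrite coef_poly.
case: ltnP => [kn|nk]; last by rewrite nth_default// (leq_trans sf).
have hk := hB k kn; rewrite ffunE (inordK kn) inordK; lia.
Qed.

(* By finite_dominant_box, the set is finite, so this is its cardinality. *)
Definition D (R : realType) (n : nat) (eps : R) (H : nat) : nat :=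
  #|` fset_set (dominant_box n eps H)|%fset.

(* Main.v *)
Require Import Defs.
From mathcomp Require Import all_boot all_order all_algebra.
From mathcomp Require Import finmap complex zify ring lra.
From mathcomp Require Import all_classical all_reals all_analysis.
Import Order.TTheory GRing.Theory Num.Theory.
Import numFieldNormedType.Exports.
Local Open Scope classical_set_scope.
Local Open Scope ring_scope.

(* If a_1 is large compared with a_0, every root far from the origin is close to
   c = - a_1 / a_0: for such a root z, the equation f(z) = 0 gives
   |a_0 z + a_1| = O(H / |z|). Since the roots sum to c, exactly one root is far,
   so f is dominant. Quantitatively, it suffices that |a_1| > K with
   K = 2 n T |a_0|_max and 2 H <= T^2 |a_0|_max; the choice T ~ 2 H^(eps/2) makes
   K = O(H^(1 - eps/2)) = o(H), so almost all coefficient vectors qualify. *)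

(** * Root location and a coefficient criterion for dominance *)

(** Since [z] is a root, [z ^+ m.+1] times the bracket is minus the sum of the [m.+1] lower terms,
    each at most [h * |z|^m] as [|z| >= 1]. Cancelling [|z|^m] leaves a factor [|z|], which exceeds
    [T]. *)
Lemma root_near (C : numFieldType) (m : nat) (f : {poly C}) (z h T : C) :
    size f = m.+3 -> root f z -> 1 <= T -> T < `|z| ->
    (forall i, (i <= m)%N -> `|f`_i| <= h) ->
  T * `|f`_m.+2 * z + f`_m.+1| <= m.+1%:R * h.
Proof.
move=> sf /rootP; rewrite horner_coef sf 2!big_ord_recr/= => fz T1 Tz fh.
have z1 : 1 <= `|z| by rewrite ltW// (le_lt_trans T1).
have z0 : 0 < `|z| by rewrite (lt_le_trans _ z1).
have h0 : 0 <= h by rewrite (le_trans _ (fh 0%N _)).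
apply: (@le_trans _ _ (`|z| * `|f`_m.+2 * z + f`_m.+1|)).
  by rewrite ler_wpM2r// ltW.
rewrite -(ler_pM2l (exprn_gt0 m z0)) mulrA -exprSr -normrX -normrM.
have -> : z ^+ m.+1 * (f`_m.+2 * z + f`_m.+1) = - \sum_(i < m.+1) f`_i * z ^+ i.
  apply/eqP; rewrite -addr_eq0 -[X in _ == X]fz; apply/eqP.
  by rewrite [z ^+ m.+2]exprS; ring.
rewrite normrN (le_trans (ler_norm_sum _ _ _))//.
rewrite mulrCA mulr_natl -[X in _ *+ X]card_ord -sumr_const ler_sum// => i _.
have im : (i <= m)%N by rewrite -ltnS.
by rewrite normrM normrX mulrC ler_pM ?exprn_ge0// ?ler_weXn2l// fh.
Qed.

(** Let k be the number of far indices. Subtracting one copy of [c] per far index shows that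
    [(1 - k) c] is the sum of the far deviations [a i - c] and of the near values. Hence
    [|1 - k| |c|] is at most [k |c| / 4 + #|I| T], which is below [k |c| / 4 + |c| / 2]. *)
Lemma unique_far (C : numFieldType) (I : finType) (a : I -> C) (T : C) :
    let c := \sum_i a i in
    0 <= T -> (2 * #|I|)%:R * T < `|c| ->
    (forall i, T < `|a i| -> 4 * `|a i - c| <= `|c|) ->
  exists i, forall j, j != i -> `|a j| < `|a i|.
Proof.
move=> c T0 Tc far.
have c0 : 0 < `|c| by rewrite (le_lt_trans _ Tc)// mulr_ge0.
pose A := [set i | T < `|a i|]%SET.
have nA i : i \notin A -> `|a i| <= T.
  by rewrite inE -real_leNgt ?normr_real ?ger0_real.
have cE : c - #|A|%:R * c = \sum_(i in A) (a i - c) + \sum_(i | i \notin A) a i.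
  rewrite big_split/= sumr_const mulNrn mulr_natl addrAC; congr (_ - _).
  by rewrite /c (bigID (mem A)).
have : 4 * `|1 - #|A|%:R| < #|A|%:R + 2 :> C.
  rewrite -(ltr_pM2r c0) -mulrA -normrM mulrBl mul1r cE.
  apply: (@le_lt_trans _ _ (#|A|%:R * `|c| + 4 * (#|I|%:R * T))); last first.
    rewrite [ltRHS]mulrDl ltrD2l (_ : 4 = 2 * 2); last by ring.
    by rewrite -mulrA ltr_pM2l// mulrA -natrM.
  rewrite (le_trans (ler_wpM2l _ (ler_normD _ _)))// mulrDr lerD//.
    rewrite (le_trans (ler_wpM2l _ (ler_norm_sum _ _ _)))// mulr_sumr.
    by rewrite mulr_natl -sumr_const ler_sum// => i; rewrite inE => /far.
  rewrite ler_wpM2l// (le_trans (ler_norm_sum _ _ _))//.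
  rewrite (le_trans (ler_sum _ (fun i => nA i)))//.
  by rewrite sumr_const -[leLHS]mulr_natl ler_wpM2r// ler_nat max_card.
(* An empty [A] would give 4 < 2; otherwise 4(k - 1) < k + 2 forces k = 1. *)
have [->|A0] := posnP #|A|; first by rewrite subr0 normr1 mulr1 add0r ltr_nat.
rewrite distrC -[X in _ - X]/(1%:R) -natrB// normr_nat -natrM -natrD ltr_nat => A1.
have /eqP/cards1P[i Ai] : #|A| = 1%N by lia.
exists i => j ji; apply: (@le_lt_trans _ _ T).
  by apply: nA; rewrite Ai inE.
have : i \in A by rewrite Ai inE.
by rewrite inE.
Qed.

(** By Vieta the root sum is c = -a_1/a_0. The last hypothesis, divided by [|a_0|], is the size
    condition of [unique_far]; the one before it turns the bound of [root_near] into
    [4 |z - c| <= |c|] for every far root z. *)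
Lemma dominant_coefs (C : numClosedFieldType) (m : nat) (f : {poly C}) (h T : C) :
    size f = m.+3 -> 1 <= T -> (forall i, (i <= m)%N -> `|f`_i| <= h) ->
    (4 * m.+1)%:R * h <= T * `|f`_m.+1| ->
    (2 * m.+2)%:R * T * `|f`_m.+2| < `|f`_m.+1| ->
  dominant f.
Proof.
move=> sf T1 fh hT Tf.
have [r fE] := closed_field_poly_normal f.
have l0 : lead_coef f != 0 by rewrite lead_coef_eq0 -size_poly_eq0 sf.
have sr : size r = m.+2.
  by move: sf; rewrite {1}fE size_scale// size_prod_XsubC => -[].
pose a (i : 'I_m.+2) := r`_i.
have rE : \prod_(z <- r) ('X - z%:P) = \prod_(i < m.+2) ('X - (a i)%:P).
  by rewrite (big_nth 0) big_mkord sr.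
have lE : lead_coef f = f`_m.+2 by rewrite lead_coefE sf.
have f1 : f`_m.+1 = - (f`_m.+2 * \sum_i a i).
  rewrite {1}fE coefZ lE -mulrN; congr (_ * _).
  have /= := @coefPn_prod_XsubC _ r; rewrite sr/= => ->//.
  by rewrite (big_nth 0) big_mkord sr.
have T0 : 0 <= T by exact: le_trans T1.
have l0' : 0 < `|f`_m.+2| by rewrite normr_gt0 -lE.
exists m.+2, a; split=> //; first by rewrite -rE.
apply: (@unique_far _ _ _ T) => //.
  by rewrite card_ord -(ltr_pM2r l0') [ltRHS]mulrC -normrM -[ltRHS]normrN -f1.
move=> i Ti.
have rfi : root f (a i).
  by rewrite fE rootZ// root_prod_XsubC mem_nth// sr.
have := root_near _ _ _ _ _ _ sf rfi T1 Ti fh.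
rewrite f1 -mulrBr normrM => near.
rewrite -(ler_pM2l l0') -(ler_pM2l (lt_le_trans ltr01 T1)).
move: hT; rewrite f1 normrN normrM; apply: le_trans.
rewrite natrM -mulrA.
rewrite [leLHS](_ : _ = 4 * (T * (`|f`_m.+2| * `|a i - \sum_i a i|))); last by ring.
by rewrite ler_wpM2l.
Qed.

Lemma dominant_int (C : numClosedFieldType) (m F H T : nat) (f : {poly int}) :
    (size f <= m.+3)%N -> (0 < absz (f`_m.+2)%R <= F)%N ->
    (forall i, (i <= m)%N -> (absz (f`_i)%R <= H)%N) ->
    (0 < T)%N -> (2 * H <= T ^ 2 * F)%N ->
    (2 * m.+2 * T * F < absz (f`_m.+1)%R)%N ->
  @dominant C (map_poly intr f).
Proof.
move=> sf /andP[l0 lF] fH T0 HT Tf.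
have normE k : `|(map_poly intr f)`_k| = (absz (f`_k)%R)%:R :> C.
  by rewrite coef_map/= natr_absz intr_norm.
apply: (@dominant_coefs C m _ H%:R T%:R).
- rewrite size_map_inj_poly//; last exact: intr_inj.
  apply/eqP; rewrite eqn_leq sf/= ltnNge; apply/negP => /leq_sizeP/(_ _ (leqnn _)).
  by move=> l00; rewrite l00 in l0.
- by rewrite ler1n.
- by move=> i im; rewrite normE ler_nat fH.
(* T|a_1| >= 2(m+2) T^2 F >= 4(m+2) H. *)
- rewrite !normE -!natrM ler_nat; nia.
- rewrite !normE -!natrM ltr_nat; nia.
Qed.

(** * Enumeration of coefficient boxes *)

(** Zero is left out even for [K = 0], so the same list serves for nonzero leading coefficients and
    for large a_1. *)
Definition annulus (K H : nat) : seq int :=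
  [seq k%:Z | k <- iota K.+1 (H - K)] ++ [seq - k%:Z | k <- iota K.+1 (H - K)].

Lemma mem_annulus K H x : (x \in annulus K H) = (K < absz x <= H)%N.
Proof.
rewrite mem_cat; apply/orP/idP.
  by case=> /mapP[k]; rewrite mem_iota => kH ->; lia.
move=> xH; have [x0|x0] := leP 0 x; [left|right]; apply/mapP;
  by exists (absz x); rewrite ?mem_iota; lia.
Qed.

Lemma annulus_uniq K H : uniq (annulus K H).
Proof.
rewrite cat_uniq !map_inj_uniq ?iota_uniq//=; [|by move=> x y; lia..].
rewrite andbT; apply/hasPn => _ /mapP[k + ->]; rewrite mem_iota => kH.
by apply/mapP => -[l]; rewrite mem_iota; lia.
Qed.

Lemma size_annulus K H : size (annulus K H) = (2 * (H - K))%N.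
Proof. by rewrite size_cat !size_map size_iota; lia. Qed.

(** [S i] lists the values allowed for the coefficient of X^i. With duplicate-free lists,
    cardinality bounds reduce to inclusions, through [uniq_leq_size]. *)
Fixpoint coef_box (S : nat -> seq int) (n : nat) : seq {poly int} :=
  if n is k.+1 then [seq f + x *: 'X^k | f <- coef_box S k, x <- S k]
  else [:: 0].

Lemma size_coef_box S n : size (coef_box S n) = (\prod_(i < n) size (S i))%N.
Proof.
elim: n => [|n IH]/=; first by rewrite big_ord0.
by rewrite size_allpairs IH big_ord_recr.
Qed.

Lemma mem_coef_box S n (f : {poly int}) :
  reflect ((size f <= n)%N /\ forall i, (i < n)%N -> f`_i \in S i)
          (f \in coef_box S n).
Proof.
elim: n f => [|n IH] f /=.
  by rewrite inE leqn0 size_poly_eq0; apply: (iffP idP) => [->|[]].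
apply: (iffP allpairsP) => [[[g x] /= [/IH[sg gS] xS ->]]|[sf fS]].
  split.
    rewrite (leq_trans (size_polyD _ _))// geq_max leqW//=.
    by rewrite (leq_trans (size_scale_leq _ _))// size_polyXn.
  move=> i; rewrite ltnS coefD coefZ coefXn leq_eqVlt => /predU1P[->|ltin].
    by rewrite nth_default// eqxx mulr1 add0r.
  by rewrite ltn_eqF// mulr0 addr0 gS.
exists (take_poly n f, f`_n); split; last 1 first.
- rewrite /= -{1}(poly_take_drop n f); congr (_ + _).
  rewrite [drop_poly n f]size1_polyC ?size_drop_poly ?leq_subLR ?addn1//.
  by rewrite coef_drop_poly mul_polyC.
- apply/IH; split=> [|i ltin]/=; first exact: size_take_poly.
  by rewrite coef_take_poly ltin fS// ltnS ltnW.
- exact: fS.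
Qed.

Lemma coef_box_uniq S n : (forall i, uniq (S i)) -> uniq (coef_box S n).
Proof.
move=> uS; elim: n => [//|n IH]/=; apply: allpairs_uniq => // -[f x] [g y].
move=> /allpairsP[[f' x'] [/= /mem_coef_box[sf _] _ [-> ->]]].
move=> /allpairsP[[g' y'] [/= /mem_coef_box[sg _] _ [-> ->]]] /= fg.
have xy : x' = y'.
  have := congr1 (fun p : {poly int} => p`_n) fg.
  by rewrite !coefD !coefZ coefXn eqxx !mulr1 !nth_default// !add0r.
by move: fg; rewrite xy => /addIr ->.
Qed.

Definition ball_seq (H : nat) : seq int := 0 :: annulus 0 H.

Lemma mem_ball_seq H x : (x \in ball_seq H) = (absz x <= H)%N.
Proof. by rewrite inE mem_annulus; lia. Qed.

Lemma ball_seq_uniq H : uniq (ball_seq H).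
Proof. by rewrite /= annulus_uniq mem_annulus. Qed.

Lemma size_ball_seq H : size (ball_seq H) = (2 * H).+1.
Proof. by rewrite /= size_annulus subn0. Qed.

(** * Upper and lower bounds for the count *)

Lemma D_le (R : realType) (eps : R) (m H : nat) :
  (D m.+2 eps H
    <= 2 * Num.trunc (H%:R `^ (1 - eps))%R * (2 * H).+1 ^ m.+2)%N.
Proof.
set F := Num.trunc _.
pose S i := if i == m.+2 then annulus 0 F else ball_seq H.
have -> : (2 * F * (2 * H).+1 ^ m.+2 = size (coef_box S m.+3))%N.
  rewrite size_coef_box big_ord_recr/= {2}/S eqxx size_annulus subn0 mulnC.
  congr (_ * _)%N; rewrite -[X in (_ ^ X)%N]card_ord -prod_nat_const.
  by apply: eq_bigr => i _; rewrite /S ltn_eqF// size_ball_seq.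
rewrite /D; apply: uniq_leq_size; first exact: fset_uniq.
move=> f; rewrite in_fset_set; last exact: finite_dominant_box.
rewrite inE => -[sf f0 fF fH _]; apply/mem_coef_box; split=> // i.
rewrite ltnS /S leq_eqVlt; case: eqP => [-> _|_ /= ltin].
  by rewrite mem_annulus truncn_ge_nat ?powR_ge0// natr_absz fF andbT -ltz_nat abszE.
(* The coefficient of X^i is a_(m+2-i), so the bound is read at the complementary index. *)
have := fH (m.+2 - i)%N; rewrite subKn ?(ltnW ltin)// mem_ball_seq.
by move=> fiH; rewrite -lez_nat abszE fiH//; lia.
Qed.

(** Confining a_1 to K < |a_1| <= H makes every polynomial of the box dominant, by [dominant_int].
    If K >= H, the truncated subtraction makes the bound 0. *)
Lemma D_ge (R : realType) (eps : R) (m H T : nat)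
    (F := Num.trunc (H%:R `^ (1 - eps))) (K := (2 * m.+2 * T * F)%N) :
    (0 < T)%N -> (2 * H <= T ^ 2 * F)%N ->
  (2 * F * (2 * (H - K)) * (2 * H).+1 ^ m.+1 <= D m.+2 eps H)%N.
Proof.
move=> T0 HT.
pose S i := if i == m.+2 then annulus 0 F else
  if i == m.+1 then annulus K H else ball_seq H.
have -> : (2 * F * (2 * (H - K)) * (2 * H).+1 ^ m.+1 = size (coef_box S m.+3))%N.
  rewrite size_coef_box 2!big_ord_recr/= {2 3}/S ltn_eqF// !eqxx.
  rewrite !size_annulus subn0 [RHS]mulnC -mulnA; congr (_ * _)%N.
  rewrite mulnC; congr (_ * _)%N.
  rewrite -[X in (_ ^ X)%N]card_ord -prod_nat_const.
  apply: eq_bigr => i _; rewrite /S !ltn_eqF ?size_ball_seq//.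
  by rewrite ltnS ltnW.
rewrite /D; apply: uniq_leq_size.
  apply: coef_box_uniq => i; rewrite /S.
  by do 2?[case: ifP => _]; rewrite ?annulus_uniq ?ball_seq_uniq.
move=> f /mem_coef_box[sf fS].
rewrite in_fset_set; last exact: finite_dominant_box.
have := fS m.+2 (leqnn _); rewrite /S eqxx mem_annulus => fF.
have := fS m.+1 (leqW (leqnn _)).
rewrite /S ltn_eqF// eqxx mem_annulus => /andP[fK f1H].
have fH i : (i <= m)%N -> (absz (f`_i)%R <= H)%N.
  move=> im; have := fS i; rewrite !ltnS /S !ltn_eqF ?mem_ball_seq ?ltnS//.
  + by apply; rewrite !leqW.
  + by rewrite leqW.
rewrite inE; split=> //.
- by rewrite -abszE ltz_nat; case/andP: fF.
- rewrite -natr_absz -truncn_ge_nat ?powR_ge0//.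
  by case/andP: fF.
- move=> i i1.
  rewrite -abszE lez_nat; have [->|i2] := eqVneq i 1%N.
    by rewrite subSS subn0.
  by apply: fH; lia.
- exact: (@dominant_int _ m F H T).
Qed.

(** * Asymptotics and choice of the cutoff *)

Lemma cvg_powRN (R : realType) (a : R) : 0 < a ->
  (fun H : nat => H%:R `^ (- a) : R) @ \oo --> 0.
Proof.
move=> a0; under eq_fun do rewrite powRN.
apply/gtr0_cvgV0.
  by near=> H; rewrite powR_gt0// ltr0n; near: H; exact: nbhs_infty_gt.
apply/cvgryPge => A; near=> H.
apply: (@le_trans _ _ `|A|); first exact: ler_norm.
(* [|A|] is the a-th power of [|A| ^ (1/a)], so any H above the latter suffices. *)
rewrite -[leLHS]powRr1// -[X in _ `^ X](mulVf (lt0r_neq0 a0)) powRrM.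
rewrite ge0_ler_powR ?nnegrE ?powR_ge0 ?(ltW a0)//.
by near: H; exact: nbhs_infty_ger.
Unshelve. all: by end_near. Qed.

Lemma cvg_truncn_ratio (R : realType) (a : R) : 0 <= a ->
  (fun H : nat => (Num.trunc (H%:R `^ a))%:R / H%:R `^ a : R) @ \oo --> (1 : R).
Proof.
(* For [a = 0], reached when eps = 1, H^(-a) does not decay, but the ratio is constantly 1. *)
rewrite le_eqVlt => /predU1P[<-|a0].
  apply: cvg_near_cst; apply: nearW => H.
  by rewrite powRr0 truncn1 divr1.
apply: (@squeeze_cvgr _ _ _ _ (fun H : nat => 1 - H%:R `^ (- a)) (fun=> 1)).
- near=> H; have x0 : (0 : R) < H%:R `^ a.
    by rewrite powR_gt0// ltr0n; near: H; exact: nbhs_infty_gt.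
  have /andP[Fl Fu] := truncn_itv (ltW x0).
  rewrite ler_pdivlMr// ler_pdivrMr// mul1r Fl andbT.
  by rewrite powRN mulrBl mul1r mulVf ?gt_eqF// lerBlDr natr1 ltW.
- rewrite -[X in _ --> X]subr0; apply: cvgB; [exact: cvg_cst|exact: cvg_powRN].
- exact: cvg_cst.
Unshelve. all: by end_near. Qed.

Definition cutoff (R : realType) (eps : R) (H : nat) : nat :=
  (Num.trunc (2 * H%:R `^ (eps / 2) : R)).+1.

(** Put s = H^(eps/2) and X = H^(1-eps), so that H = s^2 X. The factor 2 in [cutoff] absorbs the
    truncation of X: T > 2s and F >= X/2 give T^2 F >= 4 s^2 X/2 = 2H. *)
Lemma cutoff_sqr (R : realType) (eps : R) (H : nat)
    (F := Num.trunc (H%:R `^ (1 - eps))) :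
    eps <= 1 -> (0 < H)%N ->
  (2 * H <= cutoff _ eps H ^ 2 * F)%N.
Proof.
move=> eps1 H0; set T := cutoff _ eps H; pose X : R := H%:R `^ (1 - eps).
have x1 : (1 : R) <= H%:R by rewrite ler1n.
have x0 : (0 : R) < H%:R by exact: lt_le_trans x1.
have X1 : 1 <= X by rewrite -(powRr0 H%:R) ler_powR// subr_ge0.
rewrite -(ler_nat R) natrM natrM natrX.
pose s : R := H%:R `^ (eps / 2).
have s0 : 0 < s by rewrite powR_gt0.
have xE : H%:R = s ^+ 2 * X.
  rewrite -powR_mulrn ?powR_ge0// -powRrM divfK// -powRD.
    by rewrite addrC subrK powRr1// ltW.
  by rewrite (gt_eqF x0) implybT.
have F1 : (1 : R) <= F%:R by rewrite ler1n truncn_gt0.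
(* X < F + 1 and F >= 1, the latter because eps <= 1. *)
have FX : X <= 2 * F%:R.
  have := truncnS_gt X; rewrite -/F -natr1; lra.
have Ts : 2 * s <= T%:R by rewrite ltW// truncnS_gt.
apply: (@le_trans _ _ ((2 * s) ^+ 2 * F%:R)).
  by rewrite xE exprMn; have := sqr_ge0 s; nra.
by rewrite ler_wpM2r// ler_sqr ?nnegrE// mulr_ge0// ltW.
Qed.

(** The 6 is 2 times 3: T <= 2s + 1 <= 3s as s >= 1, while F <= X and s X = H^(1-eps/2). *)
Lemma cutoff_le (R : realType) (eps : R) (n H : nat)
    (F := Num.trunc (H%:R `^ (1 - eps))) :
    0 < eps -> eps <= 1 -> (0 < H)%N ->
  (2 * n * cutoff _ eps H * F)%:R
    <= 6 * n%:R * H%:R `^ (- (eps / 2)) * H%:R :> R.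
Proof.
move=> eps0 eps1 H0; set T := cutoff _ eps H; pose X : R := H%:R `^ (1 - eps).
have x1 : (1 : R) <= H%:R by rewrite ler1n.
have x0 : (0 : R) < H%:R by exact: lt_le_trans x1.
have X1 : 1 <= X by rewrite -(powRr0 H%:R) ler_powR// subr_ge0.
pose s : R := H%:R `^ (eps / 2).
have s1 : 1 <= s by rewrite -(powRr0 H%:R) ler_powR// divr_ge0// ltW.
have FX : F%:R <= X by rewrite truncn_le (le_trans _ X1).
have Ts : T%:R <= 3 * s.
  have : (Num.trunc (2 * s))%:R <= 2 * s by rewrite truncn_le; lra.
  by rewrite /T /cutoff -natr1 -/s; lra.
have xE : H%:R `^ (- (eps / 2)) * H%:R = s * X.
  rewrite -[X in _ * X]powRr1 ?(ltW x0)// -!powRD ?(gt_eqF x0) ?implybT//.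
  by congr (_ `^ _); lra.
rewrite -mulrA xE !natrM.
rewrite [leRHS](_ : _ = 2 * n%:R * (3 * s) * X); last by ring.
by rewrite ler_pM// ?ler_wpM2l// ?mulr_ge0.
Qed.

Theorem theorem1p2 (R : realType) (eps : R) (n : nat)
    (eps_gt0 : 0 < eps) (eps_le1 : eps <= 1) (n_ge2 : (2 <= n)%N) :
  (fun H : nat =>
     (D n eps H)%:R / (2 * H%:R `^ (1 - eps) * (2 * H%:R) ^+ n) : R)
    @ \oo --> (1 : R).
Proof.
case: n n_ge2 => [//|[//|m]] _.
(* The lower function is the bound of [D_ge] with K replaced by its estimate from [cutoff_le] and
   2H+1 by 2H, divided by the main term. The upper one comes from [D_le] with F <= H^(1-eps) and
   (2H+1)/(2H) = 1 + 1/(2H). *)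
apply: (@squeeze_cvgr _ _ _ _
  (fun H : nat => (Num.trunc (H%:R `^ (1 - eps)))%:R / H%:R `^ (1 - eps) *
     (1 - 6 * m.+2%:R * H%:R `^ (- (eps / 2))))
  (fun H : nat => (1 + 2^-1 * H%:R `^ (- 1)) ^+ m.+2)); last 2 first.
- rewrite -[X in _ --> X]mulr1; apply: cvgM.
    by apply: cvg_truncn_ratio; rewrite subr_ge0.
  rewrite -[X in _ --> X]subr0; apply: cvgB; first exact: cvg_cst.
  rewrite -[X in _ --> X](mulr0 (6 * m.+2%:R)).
  by apply: cvgM; [exact: cvg_cst|apply: cvg_powRN; rewrite divr_gt0].
- have base : (fun H : nat => 1 + 2^-1 * H%:R `^ (- 1)) @ \oo --> (1 : R).
    rewrite -[X in _ --> X]addr0; apply: cvgD; first exact: cvg_cst.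
    rewrite -[X in _ --> X](mulr0 2^-1).
    by apply: cvgM; [exact: cvg_cst|exact: cvg_powRN].
  have := @exprn_continuous R m.+2 1; rewrite /continuous_at expr1n.
  exact: cvg_comp base.
near=> H.
have H0 : (0 < H)%N by near: H; exact: nbhs_infty_gt.
have x0 : (0 : R) < H%:R by rewrite ltr0n.
have X0 : 0 < H%:R `^ (1 - eps) by rewrite powR_gt0.
have P0 : 0 < 2 * H%:R `^ (1 - eps) * (2 * H%:R) ^+ m.+2.
  by apply: mulr_gt0; [exact: mulr_gt0|exact/exprn_gt0/mulr_gt0].
rewrite ler_pdivlMr// ler_pdivrMr//; apply/andP; split.
  have := D_ge _ eps m _ _ (ltn0Sn _) (cutoff_sqr _ _ _ eps_le1 H0).
  have := cutoff_le _ _ m.+2 _ eps_gt0 eps_le1 H0.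
  set T := cutoff _ _ _; set F := Num.trunc (H%:R `^ (1 - eps)).
  set K := (2 * m.+2 * T * F)%N => KH; rewrite -(ler_nat R); apply: le_trans.
  rewrite !natrM natrX.
  (* Truncated subtraction can only increase the difference, so K > H is covered as well. *)
  have HK : H%:R - K%:R <= (H - K)%:R :> R.
    by rewrite lerBlDr -natrD ler_nat; lia.
  apply: (@le_trans _ _ (2 * F%:R * (2 * (H - K)%:R) * (2 * H%:R) ^+ m.+1)).
    rewrite [leLHS](_ : _ = 2 * F%:R *
      (2 * (H%:R - 6 * m.+2%:R * H%:R `^ (- (eps / 2)) * H%:R)) *
      (2 * H%:R) ^+ m.+1).
      rewrite ler_wpM2r ?exprn_ge0 ?mulr_ge0//.
      rewrite ler_wpM2l ?mulr_ge0// ler_wpM2l//.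
      by rewrite (le_trans _ HK)// lerB.
    by rewrite [in LHS]exprS; field; rewrite gt_eqF.
  rewrite ler_wpM2l ?mulr_ge0// lerXn2r ?nnegrE ?mulr_ge0//.
  by rewrite -natrM ler_nat.
have := D_le _ eps m H; rewrite -(ler_nat R) => /le_trans; apply.
rewrite powR_inv1// mulrCA -exprMn.
rewrite (_ : _ * (2 * H%:R) = (2 * H).+1%:R); last first.
  by rewrite -[RHS]natr1 natrM; field; rewrite gt_eqF.
rewrite 2!natrM natrX ler_wpM2r ?exprn_ge0// ler_wpM2l//.
by rewrite truncn_le ltW.
Unshelve. all: by end_near. Qed.
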